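(* Let $A=\varinjlim(M_{k_n},\iota_n)$ be a unital UHF-algebra, written as a direct limit over $n\in\mathbb{N}$ of full matrix algebras $M_{k_n}=M_{k_n}(\mathbb{C})$ with unital connecting maps $\iota_n\colon M_{k_n}\to M_{k_{n+1}}$. For each $n$ let $\alpha^{(n)}\colon\mathbb{T}\to\mathrm{Aut}(M_{k_n})$ be a continuous action with $\iota_n\circ\alpha^{(n)}_\zeta=\alpha^{(n+1)}_\zeta\circ\iota_n$ for all $n\in\mathbb{N}$ and $\zeta\in\mathbb{T}$, and let $\alpha=\varinjlim\alpha^{(n)}\colon\mathbb{T}\to\mathrm{Aut}(A)$ be the resulting direct limit action. Then $\alpha$ does not have the Rokhlin property.
   Context: $\mathbb{T}$ is the circle group, identified with the complex numbers of modulus $1$; $\mathbb{N}=\{1,2,\ldots\}$; actions are continuous group homomorphisms into $\mathrm{Aut}(A)$ with the topology of pointwise norm convergence. A continuous action $\alpha\colon\mathbb{T}\to\mathrm{Aut}(A)$ on a unital $C^*$-algebra $A$ has the Rokhlin property if for every finite subset $F\subseteq A$ and every $\varepsilon>0$ there exists a unitary $u\in A$ such that $\|\alpha_\zeta(u)-\zeta u\|<\varepsilon$ for all $\zeta\in\mathbb{T}$ and $\|ua-au\|<\varepsilon$ for all $a\in F$. *)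

(* Defs.v *)
From HB Require Import structures.
From mathcomp Require Import all_boot all_order all_algebra.
From mathcomp Require Import all_classical all_reals all_analysis.
From mathcomp Require Import complex ring lra.
Set Implicit Arguments.
Unset Strict Implicit.
Unset Printing Implicit Defensive.
Import Order.TTheory GRing.Theory Num.Theory numFieldNormedType.Exports.
Local Open Scope classical_set_scope.
Local Open Scope ring_scope.
Local Open Scope complex_scope.

Notation normc := (@Normc.normc _).

(* The norm is part of this structure, and real-valued, because the join of
   the library's algebra structures with its normed module structures (whose
   norm would take its values in R[i]) cannot be declared: it lacks a common
   ancestor with numDomainType.  As an algType is a nonzero ring, every member
   of cstarAlgType is a nonzero unital C*-algebra. *)
HB.mixin Record Algebra_isCStarAlgebra (R : realType) A
    & GRing.Algebra R[i] A := {
  star : A -> A;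
  cnorm : A -> R;
  starK : involutive star;
  starD : {morph star : x y / x + y};
  starZ : forall (c : R[i]) (x : A), star (c *: x) = c^* *: star x;
  starM : forall x y : A, star (x * y) = star y * star x;
  ler_cnormD : forall x y : A, cnorm (x + y) <= cnorm x + cnorm y;
  cnormZ : forall (c : R[i]) (x : A), cnorm (c *: x) = normc c * cnorm x;
  cnorm0_eq0 : forall x : A, cnorm x = 0 -> x = 0;
  ler_cnormM : forall x y : A, cnorm (x * y) <= cnorm x * cnorm y;
  cnorm_starM : forall x : A, cnorm (star x * x) = cnorm x ^+ 2;
  cnorm_complete : forall u : nat -> A,
    (forall e : R, 0 < e -> exists N, forall m n, (N <= m)%N -> (N <= n)%N ->
       cnorm (u m - u n) < e) ->
    exists l : A, cnorm (u n - l) @[n --> \oo] --> (0 : R)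
}.

#[short(type="cstarAlgType")]
HB.structure Definition CStarAlgebra (R : realType) :=
  {A of GRing.Algebra R[i] A & Algebra_isCStarAlgebra R A}.

Section CStarTheory.
Variable R : realType.

Record unital_star_hom (A B : cstarAlgType R) (f : A -> B) : Prop :=
  UnitalStarHom {
    ush_linear : linear f;
    ush_mul : {morph f : x y / x * y};
    ush_one : f 1 = 1;
    ush_star : {morph f : x / star x}
  }.

Definition star_automorphism (A : cstarAlgType R) (f : A -> A) : Prop :=
  unital_star_hom f /\ bijective f.

Definition unitary (A : cstarAlgType R) (u : A) : Prop :=
  star u * u = 1 /\ u * star u = 1.

(* Direct limit of A_0 -> A_1 -> ... in the category of unital C*-algebras and
   unital *-homomorphisms, given by its universal property. *)
Record is_direct_limit (M : nat -> cstarAlgType R)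
    (iota : forall n, M n -> M n.+1)
    (A : cstarAlgType R) (phi : forall n, M n -> A) : Prop := IsDirectLimit {
  dl_hom : forall n, unital_star_hom (phi n);
  dl_cocone : forall n x, phi n.+1 (iota n x) = phi n x;
  dl_exists : forall (B : cstarAlgType R) (psi : forall n, M n -> B),
    (forall n, unital_star_hom (psi n)) ->
    (forall n x, psi n.+1 (iota n x) = psi n x) ->
    exists2 h : A -> B, unital_star_hom h & forall n x, h (phi n x) = psi n x;
  dl_unique : forall (B : cstarAlgType R) (h h' : A -> B),
    unital_star_hom h -> unital_star_hom h' ->
    (forall n x, h (phi n x) = h' (phi n x)) -> h =1 h'
}.

Definition circle : set R[i] := [set z | `|z| = 1].

(* Only the values of an action at points of the circle are meaningful. *)
Record circle_action (A : cstarAlgType R) := CircleAction {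
  act :> R[i] -> A -> A;
  act_aut : forall z, circle z -> star_automorphism (act z);
  act_mul : forall z w, circle z -> circle w ->
    forall x, act (z * w) x = act z (act w x);
  act_continuous : forall (x : A) z, circle z ->
    cnorm (act w x - act z x) @[w --> within circle (nbhs (z : R[i]^o))]
      --> (0 : R)
}.

Definition is_limit_action (M : nat -> cstarAlgType R) (A : cstarAlgType R)
    (phi : forall n, M n -> A) (alphan : forall n, circle_action (M n))
    (alpha : circle_action A) : Prop :=
  forall n z, circle z -> forall x, alpha z (phi n x) = phi n (alphan n z x).

Definition rokhlin_property (A : cstarAlgType R) (alpha : circle_action A) :
    Prop :=
  forall (F : set A) (e : R), finite_set F -> 0 < e ->
  exists u : A, [/\ unitary u,
    forall z, circle z -> cnorm (alpha z u - z *: u) < e &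
    forall a, F a -> cnorm (u * a - a * u) < e].

End CStarTheory.

Section OperatorNorm.
Variable R : realType.
Implicit Types (m n p : nat).

Definition l2norm n (x : 'cV[R[i]]_n) : R :=
  Num.sqrt (\sum_i normc (x i 0) ^+ 2).

Definition opnorm m n (A : 'M[R[i]]_(m, n)) : R :=
  sup [set l2norm (A *m x) | x in [set x | l2norm x <= 1]].

Definition adjmx m n (A : 'M[R[i]]_(m, n)) : 'M[R[i]]_(n, m) :=
  (map_mx conjc A)^T.

Lemma normc_ge0 (z : R[i]) : 0 <= normc z.
Proof. by case: z => a b; exact: sqrtr_ge0. Qed.

Lemma normcE0 (z : R[i]) : (normc z)%:C = `|z|.
Proof. by case: z. Qed.

Lemma normcD (x y : R[i]) : normc (x + y) <= normc x + normc y.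
Proof. exact: le_normcD. Qed.

Lemma normc_sum (I : Type) (s : seq I) (P : pred I) (f : I -> R[i]) :
  normc (\sum_(i <- s | P i) f i) <= \sum_(i <- s | P i) normc (f i).
Proof.
elim/big_ind2: _ => [|x a y b xa yb|//]; first by rewrite Normc.normc0.
by rewrite (le_trans (normcD _ _))// lerD.
Qed.

Lemma normc_conj (z : R[i]) : normc (conjc z) = normc z.
Proof. by case: z => a b /=; rewrite sqrrN. Qed.

Lemma cauchy_schwarz n (a b : 'I_n -> R) :
  (\sum_i a i * b i) ^+ 2 <= (\sum_i a i ^+ 2) * (\sum_i b i ^+ 2).
Proof.
rewrite expr2 !big_distrlr /= -subr_ge0 -(pmulr_rge0 _ (ltr0Sn R 1)).
have -> : 2 * (\sum_i \sum_j a i ^+ 2 * b j ^+ 2 -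
    \sum_i \sum_j (a i * b i) * (a j * b j)) =
    \sum_i \sum_j (a i * b j - a j * b i) ^+ 2.
  rewrite mulr_natl mulr2n.
  rewrite {1}[X in X - _]exchange_big /=.
  rewrite -!sumrB -big_split /=; apply: eq_bigr => i _.
  rewrite -!sumrB -big_split /=; apply: eq_bigr => j _; ring.
by apply: sumr_ge0 => i _; apply: sumr_ge0 => j _; rewrite sqr_ge0.
Qed.

Lemma sqr_sum_ge0 n (x : 'cV[R[i]]_n) : 0 <= \sum_i normc (x i 0) ^+ 2.
Proof. by apply: sumr_ge0 => i _; rewrite sqr_ge0. Qed.

Lemma l2norm_ge0 n (x : 'cV[R[i]]_n) : 0 <= l2norm x.
Proof. exact: sqrtr_ge0. Qed.

Lemma sqr_l2norm n (x : 'cV[R[i]]_n) :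
  l2norm x ^+ 2 = \sum_i normc (x i 0) ^+ 2.
Proof. by rewrite sqr_sqrtr// sqr_sum_ge0. Qed.

Lemma ler_sqr2 (a b : R) : 0 <= b -> a ^+ 2 <= b ^+ 2 -> a <= b.
Proof.
move=> b0 ab; have [a0|/ltW a0] := leP 0 a; last exact: le_trans b0.
by rewrite -(@ler_pXn2r _ 2)// nnegrE.
Qed.

Lemma cs_l2norm n (x y : 'cV[R[i]]_n) :
  \sum_i normc (x i 0) * normc (y i 0) <= l2norm x * l2norm y.
Proof.
apply: ler_sqr2; first by rewrite mulr_ge0 ?l2norm_ge0.
by rewrite exprMn !sqr_l2norm; exact: cauchy_schwarz.
Qed.

Lemma l2norm0 n : l2norm (0 : 'cV[R[i]]_n) = 0.
Proof.
rewrite /l2norm big1 ?sqrtr0// => i _.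
by rewrite mxE Normc.normc0 expr0n.
Qed.

Lemma l2normZ n (c : R[i]) (x : 'cV[R[i]]_n) :
  l2norm (c *: x) = normc c * l2norm x.
Proof.
apply/eqP; rewrite -(@eqrXn2 _ 2)// ?mulr_ge0 ?normc_ge0 ?l2norm_ge0//.
rewrite exprMn !sqr_l2norm mulr_sumr; apply/eqP/eq_bigr => i _.
by rewrite mxE Normc.normcM exprMn.
Qed.

Lemma l2normD n (x y : 'cV[R[i]]_n) : l2norm (x + y) <= l2norm x + l2norm y.
Proof.
apply: ler_sqr2; first by rewrite addr_ge0 ?l2norm_ge0.
rewrite sqrrD !sqr_l2norm.
apply: (@le_trans _ _ (\sum_i (normc (x i 0) + normc (y i 0)) ^+ 2)).
  apply: ler_sum => i _; rewrite mxE lerXn2r ?nnegrE ?addr_ge0 ?normc_ge0//.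
  exact: normcD.
under eq_bigr do rewrite sqrrD.
rewrite !big_split /= lerD2r lerD2l mulr2n.
rewrite lerD//; exact: cs_l2norm.
Qed.

Lemma normc_le_l2norm n (x : 'cV[R[i]]_n) i : normc (x i 0) <= l2norm x.
Proof.
apply: ler_sqr2; first exact: l2norm_ge0.
rewrite sqr_l2norm (bigD1 i)//= lerDl.
by apply: sumr_ge0 => j _; rewrite sqr_ge0.
Qed.

Lemma l2norm_eq0 n (x : 'cV[R[i]]_n) : l2norm x = 0 -> x = 0.
Proof.
move=> x0; apply/matrixP => i j; rewrite ord1 mxE.
apply: Normc.eq0_normc; apply/eqP; rewrite eq_le normc_ge0 andbT -x0.
exact: normc_le_l2norm.
Qed.

Lemma l2norm_le_sum n (x : 'cV[R[i]]_n) : l2norm x <= \sum_i normc (x i 0).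
Proof.
have s0 (P : pred 'I_n) : 0 <= \sum_(i | P i) normc (x i 0).
  by apply: sumr_ge0 => i _; exact: normc_ge0.
apply: ler_sqr2 => //.
rewrite sqr_l2norm [leRHS]expr2 mulr_suml; apply: ler_sum => i _.
rewrite expr2 ler_wpM2l ?normc_ge0// (bigD1 i)//= lerDl.
exact: s0.
Qed.

Lemma l2norm_mul_bound m n (A : 'M[R[i]]_(m, n)) (x : 'cV[R[i]]_n) :
  l2norm (A *m x) <= (\sum_i \sum_j normc (A i j)) * l2norm x.
Proof.
apply: le_trans (l2norm_le_sum _) _; rewrite mulr_suml.
apply: ler_sum => i _; rewrite mxE; apply: le_trans (normc_sum _ _ _) _.
rewrite mulr_suml; apply: ler_sum => j _.
by rewrite Normc.normcM ler_wpM2l ?normc_ge0// normc_le_l2norm.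
Qed.

Lemma opnorm_has_sup m n (A : 'M[R[i]]_(m, n)) :
  has_sup [set l2norm (A *m x) | x in [set x | l2norm x <= 1]].
Proof.
split; first by exists (l2norm (A *m 0)), 0; rewrite //= l2norm0.
exists (\sum_i \sum_j normc (A i j)) => _ [x /= x1 <-].
apply: le_trans (l2norm_mul_bound _ _) _; rewrite ler_piMr//.
by do 2!(apply: sumr_ge0 => ? _); exact: normc_ge0.
Qed.

Lemma opnorm_ge0 m n (A : 'M[R[i]]_(m, n)) : 0 <= opnorm A.
Proof.
have /sup_upper_bound := opnorm_has_sup A; apply.
by exists 0; rewrite /= ?mulmx0 l2norm0.
Qed.

Lemma le_opnorm m n (A : 'M[R[i]]_(m, n)) (x : 'cV[R[i]]_n) :
  l2norm (A *m x) <= opnorm A * l2norm x.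
Proof.
have [x0|x0] := eqVneq (l2norm x) 0.
  by rewrite (l2norm_eq0 x0) mulmx0 !l2norm0 mulr0.
have xp : 0 < l2norm x by rewrite lt0r x0 l2norm_ge0.
have nc : normc ((l2norm x)^-1%:C) = (l2norm x)^-1.
  by rewrite /= expr0n addr0 sqrtr_sqr ger0_norm// invr_ge0 ltW.
have /sup_upper_bound/(_ (l2norm (A *m ((l2norm x)^-1%:C *: x)))) :=
  opnorm_has_sup A.
rewrite -/(opnorm A) -scalemxAr l2normZ nc mulrC ler_pdivrMr//; apply.
exists ((l2norm x)^-1%:C *: x); first by rewrite /= l2normZ nc mulVf.
by rewrite -scalemxAr l2normZ nc mulrC.
Qed.

Lemma opnorm_le m n (A : 'M[R[i]]_(m, n)) (K : R) : 0 <= K ->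
  (forall x : 'cV[R[i]]_n, l2norm (A *m x) <= K * l2norm x) -> opnorm A <= K.
Proof.
move=> K0 AK; apply: ge_sup; first by case: (opnorm_has_sup A).
by move=> _ [x /= x1 <-]; rewrite (le_trans (AK x))// ler_piMr.
Qed.

Lemma opnormD m n (A B : 'M[R[i]]_(m, n)) :
  opnorm (A + B) <= opnorm A + opnorm B.
Proof.
apply: opnorm_le => [|x]; first by rewrite addr_ge0 ?opnorm_ge0.
rewrite mulmxDl mulrDl (le_trans (l2normD _ _))// lerD//; exact: le_opnorm.
Qed.

Lemma opnormZ m n (c : R[i]) (A : 'M[R[i]]_(m, n)) :
  opnorm (c *: A) = normc c * opnorm A.
Proof.
have le1 (d : R[i]) (B : 'M[R[i]]_(m, n)) :
    opnorm (d *: B) <= normc d * opnorm B.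
  apply: opnorm_le => [|x]; first by rewrite mulr_ge0 ?normc_ge0 ?opnorm_ge0.
  by rewrite -scalemxAl l2normZ -mulrA ler_wpM2l ?normc_ge0// le_opnorm.
apply/eqP; rewrite eq_le le1/=.
have [->|c0] := eqVneq c 0; first by rewrite Normc.normc0 mul0r opnorm_ge0.
have nc0 : normc c != 0 by apply: contraNneq c0 => /Normc.eq0_normc ->.
have ncp : 0 < normc c by rewrite lt0r nc0 normc_ge0.
rewrite mulrC -ler_pdivlMr// mulrC -Normc.normcV.
by rewrite -{1}(scalerK c0 A) le1.
Qed.

Lemma normc_le_opnorm m n (A : 'M[R[i]]_(m, n)) i j :
  normc (A i j) <= opnorm A.
Proof.
have e1 : l2norm (delta_mx j 0 : 'cV[R[i]]_n) = 1.
  rewrite /l2norm (bigD1 j)//= mxE !eqxx Normc.normc1 expr1n big1 ?addr0 ?sqrtr1//.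
  by move=> k kj; rewrite mxE (negbTE kj) Normc.normc0 expr0n.
have := le_opnorm A (delta_mx j 0); rewrite e1 mulr1 -colE.
by apply: le_trans; have := normc_le_l2norm (col j A) i; rewrite mxE.
Qed.

Lemma opnorm_eq0 m n (A : 'M[R[i]]_(m, n)) : opnorm A = 0 -> A = 0.
Proof.
move=> A0; apply/matrixP => i j; rewrite mxE.
apply: Normc.eq0_normc; apply/eqP; rewrite eq_le normc_ge0 andbT -A0.
exact: normc_le_opnorm.
Qed.

Lemma opnormM m n p (A : 'M[R[i]]_(m, n)) (B : 'M[R[i]]_(n, p)) :
  opnorm (A *m B) <= opnorm A * opnorm B.
Proof.
apply: opnorm_le => [|x]; first by rewrite mulr_ge0 ?opnorm_ge0.
rewrite -mulmxA (le_trans (le_opnorm _ _))// -mulrA.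
by rewrite ler_wpM2l ?opnorm_ge0// le_opnorm.
Qed.

Lemma adjmxK m n : cancel (@adjmx m n) (@adjmx n m).
Proof. by move=> A; apply/matrixP => i j; rewrite !mxE conjcK. Qed.

Lemma adjmxD m n : {morph (@adjmx m n) : A B / A + B}.
Proof. by move=> A B; apply/matrixP => i j; rewrite !mxE rmorphD. Qed.

Lemma adjmxZ m n (c : R[i]) (A : 'M[R[i]]_(m, n)) :
  adjmx (c *: A) = c^* *: adjmx A.
Proof. by apply/matrixP => i j; rewrite !mxE rmorphM. Qed.

Lemma adjmxM m n p (A : 'M[R[i]]_(m, n)) (B : 'M[R[i]]_(n, p)) :
  adjmx (A *m B) = adjmx B *m adjmx A.
Proof.
apply/matrixP => i j; rewrite !mxE rmorph_sum; apply: eq_bigr => k _.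
by rewrite !mxE rmorphM mulrC.
Qed.

Lemma sqr_l2norm_adj n (x : 'cV[R[i]]_n) :
  (adjmx x *m x) 0 0 = (l2norm x ^+ 2)%:C.
Proof.
rewrite sqr_l2norm mxE rmorph_sum; apply: eq_bigr => i _.
by rewrite !mxE rmorphXn /= normcE0 sqr_normc mulrC.
Qed.

Lemma sqr_l2norm_mul m n (A : 'M[R[i]]_(m, n)) (x : 'cV[R[i]]_n) :
  l2norm (A *m x) ^+ 2 <= opnorm (adjmx A *m A) * l2norm x ^+ 2.
Proof.
set B := adjmx A *m A.
have E : (l2norm (A *m x) ^+ 2)%:C = \sum_i conjc (x i 0) * (B *m x) i 0.
  rewrite -sqr_l2norm_adj adjmxM -mulmxA [adjmx A *m _]mulmxA -/B mxE.
  by apply: eq_bigr => i _; congr (_ * _); rewrite !mxE.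
have -> : l2norm (A *m x) ^+ 2 = normc (l2norm (A *m x) ^+ 2)%:C.
  by rewrite /= expr0n addr0 sqrtr_sqr ger0_norm// sqr_ge0.
rewrite E (le_trans (normc_sum _ _ _))//.
under eq_bigr do rewrite Normc.normcM normc_conj.
rewrite (le_trans (cs_l2norm _ _))// expr2 mulrCA.
by rewrite ler_wpM2l ?l2norm_ge0// le_opnorm.
Qed.

Lemma opnorm_adjM m n (A : 'M[R[i]]_(m, n)) :
  opnorm (adjmx A *m A) = opnorm A ^+ 2.
Proof.
have le1 p q (B : 'M[R[i]]_(p, q)) : opnorm B ^+ 2 <= opnorm (adjmx B *m B).
  rewrite -[leRHS]sqr_sqrtr ?opnorm_ge0// lerXn2r ?nnegrE ?opnorm_ge0 ?sqrtr_ge0//.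
  apply: opnorm_le => [|x]; first exact: sqrtr_ge0.
  apply: ler_sqr2; first by rewrite mulr_ge0 ?sqrtr_ge0 ?l2norm_ge0.
  by rewrite exprMn (sqr_sqrtr (opnorm_ge0 _)) sqr_l2norm_mul.
have le2 p q (B : 'M[R[i]]_(p, q)) : opnorm B <= opnorm (adjmx B).
  have [->|B0] := eqVneq (opnorm B) 0; first exact: opnorm_ge0.
  have Bp : 0 < opnorm B by rewrite lt0r B0 opnorm_ge0.
  by rewrite -(ler_pM2r Bp) -expr2 (le_trans (le1 _ _ B))// opnormM.
apply/eqP; rewrite eq_le le1 andbT (le_trans (opnormM _ _))// expr2.
by rewrite ler_wpM2r ?opnorm_ge0// (le_trans (le2 _ _ _))// adjmxK.
Qed.

Lemma opnorm_le_sum m n (A : 'M[R[i]]_(m, n)) :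
  opnorm A <= \sum_i \sum_j normc (A i j).
Proof.
apply: opnorm_le; last exact: l2norm_mul_bound.
by do 2!(apply: sumr_ge0 => ? _); exact: normc_ge0.
Qed.

Lemma Re_le_normc (z : R[i]) : `|complex.Re z| <= normc z.
Proof. by case: z => a b /=; rewrite -sqrtr_sqr ler_wsqrtr// lerDl sqr_ge0. Qed.

Lemma Im_le_normc (z : R[i]) : `|complex.Im z| <= normc z.
Proof. by case: z => a b /=; rewrite -sqrtr_sqr ler_wsqrtr// lerDr sqr_ge0. Qed.

Lemma normc_le_ReIm (z : R[i]) : normc z <= `|complex.Re z| + `|complex.Im z|.
Proof.
case: z => a b /=; apply: ler_sqr2; first by rewrite addr_ge0.
rewrite sqr_sqrtr ?addr_ge0 ?sqr_ge0// sqrrD !real_normK ?num_real//.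
by rewrite addrAC lerDl mulrn_wge0// mulr_ge0.
Qed.

Lemma real_cauchy_cvg (u : nat -> R) :
  (forall e : R, 0 < e -> exists N, forall m n, (N <= m)%N -> (N <= n)%N ->
     `|u m - u n| < e) -> cvg (u @ \oo).
Proof.
move=> uC; apply/cauchy_cvgP/cauchy_exP => e /uC[N uN].
exists (u N); exists N => // n /= Nn.
by rewrite /ball/= uN.
Qed.

Lemma cvg_sum_real n (f : 'I_n -> nat -> R) (l : 'I_n -> R) :
  (forall i, f i p @[p --> \oo] --> l i) ->
  \sum_i f i p @[p --> \oo] --> \sum_i l i.
Proof. by move=> fl; apply: cvg_big => [|i _//]; exact: add_continuous. Qed.

Lemma opnorm_complete m n (u : nat -> 'M[R[i]]_(m, n)) :
  (forall e : R, 0 < e -> exists N, forall p q, (N <= p)%N -> (N <= q)%N ->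
     opnorm (u p - u q) < e) ->
  exists l, opnorm (u p - l) @[p --> \oo] --> (0 : R).
Proof.
move=> uC.
have cRe i j : cvg (complex.Re (u p i j) @[p --> \oo]).
  apply: real_cauchy_cvg => e /uC[N uN]; exists N => p q Np Nq.
  apply: le_lt_trans (uN _ _ Np Nq); rewrite -raddfB.
  apply: le_trans (Re_le_normc _) _.
  by have := normc_le_opnorm (u p - u q) i j; rewrite !mxE.
have cIm i j : cvg (complex.Im (u p i j) @[p --> \oo]).
  apply: real_cauchy_cvg => e /uC[N uN]; exists N => p q Np Nq.
  apply: le_lt_trans (uN _ _ Np Nq); rewrite -raddfB.
  apply: le_trans (Im_le_normc _) _.
  by have := normc_le_opnorm (u p - u q) i j; rewrite !mxE.
pose a i j : R := lim (complex.Re (u p i j) @[p --> \oo]).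
pose b i j : R := lim (complex.Im (u p i j) @[p --> \oo]).
exists (\matrix_(i, j) (a i j +i* b i j)).
apply: (@squeeze_cvgr _ _ _ _ (fun=> 0)
  (fun p => \sum_i \sum_j (`|complex.Re (u p i j) - a i j| +
                           `|complex.Im (u p i j) - b i j|))).
- apply: nearW => p; rewrite opnorm_ge0/=.
  apply: le_trans (opnorm_le_sum _) _; apply: ler_sum => i _.
  apply: ler_sum => j _; apply: le_trans (normc_le_ReIm _) _.
  by rewrite !mxE !raddfB.
- exact: cvg_cst.
- have := @cvg_sum_real m (fun i p => \sum_j
      (`|complex.Re (u p i j) - a i j| + `|complex.Im (u p i j) - b i j|))
    (fun=> 0).
  rewrite big1//; apply=> i.
  have := @cvg_sum_real n (fun j p =>
      `|complex.Re (u p i j) - a i j| + `|complex.Im (u p i j) - b i j|)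
    (fun=> 0).
  rewrite big1//; apply=> j.
  have c0 (v : nat -> R) : cvg (v @ \oo) ->
      `|v p - lim (v @ \oo)| @[p --> \oo] --> (0 : R).
    move=> cv; rewrite -[X in _ --> X](@normr0 _ R) -(subrr (lim (v @ \oo))).
    by apply: cvg_norm; apply: cvgB => //; exact: cvg_cst.
  rewrite -[X in _ --> X](addr0 (0 : R)); apply: cvgD; exact: c0.
Qed.

End OperatorNorm.

(* The full matrix algebra of size n.+1 with conjugate transpose and operator
   norm; a separate name, since the library equips 'M_n with the maximum norm. *)
Definition cmatrix (R : realType) (n : nat) : Type := 'M[R[i]]_n.+1.

HB.instance Definition _ (R : realType) (n : nat) :=
  GRing.Algebra.copy (cmatrix R n) 'M[R[i]]_n.+1.

HB.instance Definition _ (R : realType) (n : nat) :=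
  @Algebra_isCStarAlgebra.Build R (cmatrix R n)
    (@adjmx R n.+1 n.+1) (@opnorm R n.+1 n.+1)
    (@adjmxK R n.+1 n.+1) (@adjmxD R n.+1 n.+1) (@adjmxZ R n.+1 n.+1)
    (@adjmxM R n.+1 n.+1 n.+1) (@opnormD R n.+1 n.+1) (@opnormZ R n.+1 n.+1)
    (@opnorm_eq0 R n.+1 n.+1) (@opnormM R n.+1 n.+1 n.+1)
    (@opnorm_adjM R n.+1 n.+1) (@opnorm_complete R n.+1 n.+1).

(* Main.v *)
Require Import Defs.
From HB Require Import structures.
From mathcomp Require Import all_boot all_order all_algebra.
From mathcomp Require Import all_classical all_reals all_analysis.
From mathcomp Require Import complex.
From mathcomp Require Import lra cyclic separable cyclotomic.

(** Why no such [alpha] has the Rokhlin property.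

    The Rokhlin property provides a unitary [u] of [A] that every [alpha z]
    moves, up to a small error, to [z *: u].  As the matrix algebras have dense
    union in [A] ([union_range_dense]), [u] is close to the image of some
    matrix [x] of size [N].  Let [z] be a primitive root of unity of order
    [m = N + 1], and average the matrices [z ^- j *: alphan n (z ^+ j) x] over
    [j < m].  The mean [y] satisfies [alphan n z y = z *: y] exactly
    ([act_rotated_mean]) and its image in [A] is still at distance less than one
    from [u] ([rotated_mean_near]), so that [y] is invertible
    ([near_unitary_unitmx]).  But the spectrum of [y] does not change under
    the automorphism [alphan n z], so it is stable under multiplication by
    [z].  Not containing 0, it has at least [m > N] points, which is absurd for
    a matrix of size [N] ([rotated_notin_unitmx]).  The order [m] has to grow
    with [N]: a Rokhlin element for a single finite cyclic group may well exist
    in a matrix algebra whose size is divisible by the order of that group.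

    Two facts on C*-algebras are needed.  The estimate for [y] has to be uniform
    in [m], hence uses that automorphisms do not increase the norm.  This is
    [ush_contract], proved without spectral theory: a self-adjoint element of
    norm less than one is a mean of two unitaries.  And density has to be
    deduced from the universal property of the direct limit, by applying that
    property to the closure of the union, which is a C*-algebra. *)

Set Implicit Arguments.
Unset Strict Implicit.
Unset Printing Implicit Defensive.
Import Order.TTheory GRing.Theory Num.Theory numFieldNormedType.Exports.
Local Open Scope classical_set_scope.
Local Open Scope ring_scope.
Local Open Scope complex_scope.

(** * Norm and convergence in a C*-algebra *)

Section Norm.
Variables (R : realType) (A : cstarAlgType R).
Implicit Types (x y a b : A) (u v : nat -> A).

Lemma normc_real (t : R) : normc t%:C = `|t|.
Proof. by rewrite /= expr0n addr0 sqrtr_sqr. Qed.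

Lemma normc_circle (z : R[i]) : circle z -> normc z = 1.
Proof.
by move=> z1; apply: complexI; rewrite normcE0 z1.
Qed.

Lemma cnorm0 : cnorm (0 : A) = 0.
Proof. by rewrite -(scale0r (0 : A)) cnormZ Normc.normc0 mul0r. Qed.

Lemma cnormN x : cnorm (- x) = cnorm x.
Proof.
rewrite -scaleN1r cnormZ.
have -> : (- 1 : R[i]) = (- 1)%:C by rewrite rmorphN1.
by rewrite normc_real normrN normr1 mul1r.
Qed.

Lemma cnormBC x y : cnorm (x - y) = cnorm (y - x).
Proof. by rewrite -cnormN opprB. Qed.

Lemma cnorm_ge0 x : 0 <= cnorm x.
Proof.
have := ler_cnormD x (- x); rewrite subrr cnorm0 cnormN -mulr2n.
by rewrite pmulrn_lge0.
Qed.

Lemma cnorm_realZ (t : R) x : 0 <= t -> cnorm (t%:C *: x) = t * cnorm x.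
Proof. by move=> t0; rewrite cnormZ normc_real ger0_norm. Qed.

Lemma cnorm_sum (I : Type) (s : seq I) (F : I -> A) :
  cnorm (\sum_(i <- s) F i) <= \sum_(i <- s) cnorm (F i).
Proof.
elim/big_ind2: _ => [|x a y b xa yb|//]; first by rewrite cnorm0.
by rewrite (le_trans (ler_cnormD _ _))// lerD.
Qed.

Lemma star0 : star (0 : A) = 0.
Proof. by apply: (addrI (star (0 : A))); rewrite -starD !addr0. Qed.

Lemma star1 : star (1 : A) = 1.
Proof. by rewrite -[LHS]mulr1 -{2}(starK (1 : A)) -starM mulr1 starK. Qed.

Lemma starN x : star (- x) = - star x.
Proof. by apply/eqP; rewrite -addr_eq0 -starD addNr star0. Qed.

Lemma starB x y : star (x - y) = star x - star y.
Proof. by rewrite starD starN. Qed.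

Lemma star_realZ (t : R) x : star (t%:C *: x) = t%:C *: star x.
Proof. by rewrite starZ; congr (_ *: _); exact: conjc_real. Qed.

Lemma star_iZ x : star ('i *: x) = - 'i *: star x.
Proof. by rewrite starZ; congr (_ *: _); rewrite conjCi. Qed.

(** The C*-identity gives [cnorm y ^+ 2 <= cnorm (star y) * cnorm y], hence one
    inequality, and the other one by involutivity. *)
Lemma cnorm_star x : cnorm (star x) = cnorm x.
Proof.
have le y : cnorm y <= cnorm (star y).
  have [->|y0] := eqVneq (cnorm y) 0; first exact: cnorm_ge0.
  have yp : 0 < cnorm y by rewrite lt0r y0 cnorm_ge0.
  by rewrite -(ler_pM2r yp) -expr2 -cnorm_starM ler_cnormM.
by apply/eqP; rewrite eq_le le andbT -{2}(starK x) le.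
Qed.

Lemma cnorm1 : cnorm (1 : A) = 1.
Proof.
have c2 := cnorm_starM (1 : A); rewrite star1 mulr1 in c2.
have /eqP : cnorm (1 : A) * (cnorm (1 : A) - 1) = 0.
  by rewrite mulrBr mulr1 -expr2 -c2 subrr.
rewrite mulf_eq0 subr_eq0.
by case/orP => /eqP // /cnorm0_eq0/eqP; rewrite oner_eq0.
Qed.

Lemma cnorm_unitary x : unitary x -> cnorm x = 1.
Proof.
case=> xx _; apply/eqP; rewrite -(@eqrXn2 _ 2) ?cnorm_ge0//.
by rewrite -cnorm_starM xx cnorm1 expr1n.
Qed.

(** Convergence is expressed through the real-valued [cnorm] because a
    [cstarAlgType] carries no topology of its own. *)
Definition ccvg u l := cnorm (u n - l) @[n --> \oo] --> (0 : R).

Lemma ccvg_squeeze u l (f : nat -> R) :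
  (forall n, cnorm (u n - l) <= f n) -> f n @[n --> \oo] --> (0 : R) ->
  ccvg u l.
Proof.
move=> uf f0; apply: (squeeze_cvgr _ (cvg_cst 0) f0).
by apply: nearW => n; rewrite cnorm_ge0 uf.
Qed.

Lemma ccvg_small u l e : ccvg u l -> 0 < e -> exists n, cnorm (u n - l) < e.
Proof.
move=> /cvgrPdist_lt ul /ul [N _ uN]; exists N.
by have := uN N (leqnn N); rewrite /= sub0r normrN ger0_norm ?cnorm_ge0.
Qed.

Lemma ccvg_cst l : ccvg (fun=> l) l.
Proof. by rewrite /ccvg subrr cnorm0; exact: cvg_cst. Qed.

Lemma ccvgD u v l m : ccvg u l -> ccvg v m -> ccvg (fun n => u n + v n) (l + m).
Proof.
move=> ul vm; apply: (@ccvg_squeeze _ _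
  (fun n => cnorm (u n - l) + cnorm (v n - m))) => [n|].
  by rewrite opprD addrACA; exact: ler_cnormD.
by rewrite -[X in _ --> X](addr0 (0 : R)); exact: cvgD.
Qed.

Lemma ccvgZ (c : R[i]) u l : ccvg u l -> ccvg (fun n => c *: u n) (c *: l).
Proof.
move=> ul; apply: (@ccvg_squeeze _ _ (fun n => normc c * cnorm (u n - l))).
  by move=> n; rewrite -scalerBr cnormZ.
by rewrite -[X in _ --> X](mulr0 (normc c)); apply: cvgM => //; exact: cvg_cst.
Qed.

(** Products of convergent sequences are controlled without bounding the
    sequences, by expanding [u n * v n] around [l * m]. *)
Lemma ccvgM u v l m : ccvg u l -> ccvg v m -> ccvg (fun n => u n * v n) (l * m).
Proof.
move=> ul vm; apply: (@ccvg_squeeze _ _ (fun n =>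
  cnorm (u n - l) * cnorm (v n - m) +
  (cnorm (u n - l) * cnorm m + cnorm l * cnorm (v n - m)))) => [n|].
  have -> : u n * v n - l * m =
      (u n - l) * (v n - m) + ((u n - l) * m + l * (v n - m)).
    by rewrite addrA -mulrDr subrK mulrBl mulrBr addrA subrK.
  by do 2![rewrite (le_trans (ler_cnormD _ _))// lerD ?ler_cnormM//].
rewrite -[X in _ --> X](addr0 (0 : R)); apply: cvgD.
  by rewrite -[X in _ --> X](mulr0 (0 : R)); apply: cvgM.
rewrite -[X in _ --> X](addr0 (0 : R)); apply: cvgD.
  rewrite -[X in _ --> X](mul0r (cnorm m)).
  by apply: cvgM => //; exact: cvg_cst.
by rewrite -[X in _ --> X](mulr0 (cnorm l)); apply: cvgM => //; exact: cvg_cst.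
Qed.

Lemma ccvg_star u l : ccvg u l -> ccvg (fun n => star (u n)) (star l).
Proof.
by move=> ul; apply: (ccvg_squeeze _ ul) => n; rewrite -starB cnorm_star.
Qed.

Lemma ccvgS u l : ccvg u l -> ccvg (fun n => u n.+1) l.
Proof. by move=> ul; rewrite /ccvg (cvg_shiftS (fun n => cnorm (u n - l))). Qed.

Lemma ccvg_unique u l m : ccvg u l -> ccvg u m -> l = m.
Proof.
move=> ul /(ccvgZ (-1)) um; apply/eqP; rewrite -subr_eq0; apply/eqP.
apply: cnorm0_eq0; have := ccvgD ul um; rewrite /ccvg.
under eq_fun do rewrite scaleN1r subrr sub0r cnormN scaleN1r.
by move=> /(cvg_unique _ (cvg_cst _)); apply.
Qed.

(** Summing the geometric series of the steps gives, after multiplication by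
    [1 - r], the telescoping bound [tail], whence the Cauchy property. *)
Lemma geometric_ccvg u (r : R) : 0 <= r -> r < 1 ->
  (forall n, cnorm (u n.+1 - u n) <= r ^+ n) -> exists l, ccvg u l.
Proof.
move=> r0 r1 ur; apply: cnorm_complete => e e0.
have r1p : 0 < 1 - r by rewrite subr_gt0.
have tail N p : cnorm (u (N + p)%N - u N) * (1 - r) <= r ^+ N - r ^+ (N + p).
  elim: p => [|p IH]; first by rewrite addn0 !subrr cnorm0 mul0r.
  rewrite addnS -(subrK (u (N + p)%N) (u _.+1)) -addrA.
  apply: le_trans (ler_wpM2r (ltW r1p) (ler_cnormD _ _)) _.
  rewrite mulrDl exprSr; have := ler_wpM2r (ltW r1p) (ur (N + p)%N).
  by move: IH; lra.
have : r ^+ n @[n --> \oo] --> (0 : R).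
  by apply: cvg_expr; rewrite ger0_norm.
move=> /cvgrPdist_lt /(_ (e * (1 - r) / 2)) [|N _ rN].
  by rewrite divr_gt0 ?mulr_gt0.
have near m : (N <= m)%N -> cnorm (u m - u N) < e / 2.
  move=> /subnKC <-; have := tail N (m - N)%N; have := rN N (leqnn N).
  rewrite /= sub0r normrN ger0_norm ?exprn_ge0// => rNe tNe.
  rewrite -(ltr_pM2r r1p) (le_lt_trans tNe)//.
  rewrite mulrAC (le_lt_trans _ rNe)// gerBl exprn_ge0//.
exists N => m n /near mN /near nN.
rewrite (splitr e) -(subrK (u N) (u m)) -addrA.
rewrite (le_lt_trans (ler_cnormD _ _))// ltrD//.
by rewrite cnormBC.
Qed.

End Norm.

(** * Square roots near the unit *)

(** The iteration [y |-> (b + y * y) / 2] maps the ball of radius [cnorm b]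
    into itself and contracts it by the factor [cnorm b]; at its fixed point
    [y], the element [1 - y] squares to [1 - b]. *)
Section SquareRoot.
Variables (R : realType) (A : cstarAlgType R) (b : A).
Hypothesis b1 : cnorm b < 1.

Definition sqrt_step (y : A) : A := 2^-1%:C *: (b + y * y).
Definition sqrt_seq n := iter n sqrt_step 0.

Let half_ge0 : 0 <= 2^-1 :> R. Proof. by rewrite invr_ge0. Qed.

Lemma cnorm_sqrt_seq n : cnorm (sqrt_seq n) <= cnorm b.
Proof.
elim: n => [|n IH]; first by rewrite cnorm0 cnorm_ge0.
rewrite /sqrt_seq iterS -/(sqrt_seq n) cnorm_realZ//.
set y := sqrt_seq n in IH *.
have y0 := cnorm_ge0 y.
have yy : cnorm y * cnorm y <= cnorm b.
  by rewrite -[leRHS]mulr1 ler_pM// (le_trans IH)// ltW.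
have := ler_cnormD b (y * y); have := ler_cnormM y y.
by move: yy; lra.
Qed.

Lemma sqrt_seq_step n : cnorm (sqrt_seq n.+1 - sqrt_seq n) <= cnorm b ^+ n.
Proof.
elim: n => [|n IH].
  rewrite subr0 expr0; have := cnorm_sqrt_seq 1.
  by have := b1; rewrite /=; lra.
set z := sqrt_seq n.+1 in IH *; set y := sqrt_seq n in IH *.
have -> : sqrt_seq n.+2 - z = 2^-1%:C *: (z * (z - y) + (z - y) * y).
  rewrite mulrBr mulrBl addrA subrK.
  have zE : z = sqrt_step y by [].
  rewrite {2}zE /sqrt_seq iterS -/(sqrt_seq n.+1) -/z.
  by rewrite -scalerBr opprD addrACA subrr add0r.
rewrite cnorm_realZ// exprS.
have z0 := cnorm_sqrt_seq n.+1; have y0 := cnorm_sqrt_seq n.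
have zy := ler_cnormD (z * (z - y)) ((z - y) * y).
have m1 := ler_cnormM z (z - y); have m2 := ler_cnormM (z - y) y.
rewrite -/z in z0; rewrite -/y in y0.
have d0 := cnorm_ge0 (z - y).
have : cnorm z * cnorm (z - y) <= cnorm b * cnorm (z - y) by rewrite ler_wpM2r.
have : cnorm (z - y) * cnorm y <= cnorm b * cnorm (z - y).
  by rewrite mulrC ler_wpM2r.
have : cnorm b * cnorm (z - y) <= cnorm b * cnorm b ^+ n.
  by rewrite ler_wpM2l ?cnorm_ge0.
by lra.
Qed.

Lemma sqrt_seq_fix y : ccvg sqrt_seq y -> sqrt_step y = y.
Proof.
move=> uy; apply: ccvg_unique (ccvgS uy).
by apply: ccvgZ; apply: ccvgD; [exact: ccvg_cst | exact: ccvgM].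
Qed.

Lemma sqrt_seq_star n : star b = b -> star (sqrt_seq n) = sqrt_seq n.
Proof.
move=> sb; elim: n => [|n IH]; first exact: star0.
rewrite /sqrt_seq iterS -/(sqrt_seq n) /sqrt_step.
by rewrite star_realZ starD starM IH sb.
Qed.

Lemma sqrt_seq_comm n a : a * b = b * a -> a * sqrt_seq n = sqrt_seq n * a.
Proof.
move=> ab; elim: n => [|n IH]; first by rewrite mulr0 mul0r.
rewrite /sqrt_seq iterS -/(sqrt_seq n) /sqrt_step.
rewrite -scalerAr -scalerAl mulrDl mulrDr ab; congr (_ *: (_ + _)).
by rewrite mulrA IH -mulrA IH mulrA.
Qed.

(** The properties of [s] pass to the limit from the iterates, which are
    polynomials in [b] with real coefficients. *)
Lemma ex_sqrt : star b = b ->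
  exists s : A, [/\ s * s = 1 - b, star s = s &
    forall a, a * b = b * a -> a * s = s * a].
Proof.
move=> sb; have [y uy] := geometric_ccvg (cnorm_ge0 b) b1 sqrt_seq_step.
exists (1 - y); split=> [||a ab].
- have := sqrt_seq_fix uy; rewrite /sqrt_step => yE.
  have half2 : 2^-1%:C + 2^-1%:C = 1 :> R[i].
    by rewrite -rmorphD /= -[2^-1]mul1r -splitr.
  have y2 : b + y * y = y + y.
    by rewrite -[LHS]scale1r -half2 scalerDl yE.
  have {}y2 : y * y = y + y - b by rewrite -y2 addrC addKr.
  have {}y2 : y - y * y = b - y by rewrite y2 -addrA opprD addNKr opprB.
  by rewrite mulrBl mul1r mulrBr mulr1 y2 opprB addrA subrK.
- rewrite starB star1; congr (_ - _); apply: ccvg_unique (ccvg_star uy) _.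
  by rewrite (_ : (fun _ => _) = sqrt_seq) //; apply/funext => n;
     exact: sqrt_seq_star.
- rewrite mulrBr mulrBl mulr1 mul1r; congr (_ - _).
  apply: (ccvg_unique (ccvgM (ccvg_cst a) uy)).
  rewrite (_ : (fun _ => _) = fun n => sqrt_seq n * a).
    exact: ccvgM uy (ccvg_cst a).
  by apply/funext => n; exact: sqrt_seq_comm.
Qed.

End SquareRoot.

(** * Unital star-homomorphisms are contractive *)

Section StarHom.
Variables (R : realType) (A B : cstarAlgType R) (f : A -> B).
Hypothesis fh : unital_star_hom f.
Implicit Types x y : A.

Lemma ush0 : f 0 = 0.
Proof.
have := ush_linear fh (-1) 0 0.
by rewrite scaleN1r addNr scaleN1r addNr.
Qed.

Lemma ushD : {morph f : x y / x + y}.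
Proof. by move=> x y; have := ush_linear fh 1 x y; rewrite !scale1r. Qed.

Lemma ushZ c : {morph f : x / c *: x}.
Proof. by move=> x; have := ush_linear fh c x 0; rewrite ush0 !addr0. Qed.

Lemma ushB : {morph f : x y / x - y}.
Proof. by move=> x y; rewrite -scaleN1r ushD ushZ scaleN1r. Qed.

Lemma ush_sum (I : Type) (s : seq I) (F : I -> A) :
  f (\sum_(i <- s) F i) = \sum_(i <- s) f (F i).
Proof. exact: (big_morph f ushD ush0). Qed.

Lemma ush_unitary x : unitary x -> unitary (f x).
Proof.
case=> xx xx'.
by split; rewrite -(ush_star fh) -(ush_mul fh) ?xx ?xx' (ush_one fh).
Qed.

(** A self-adjoint [a] with [cnorm a < 1] is the mean of the two unitaries
    [a + 'i s] and [a - 'i s], where [s * s = 1 - a * a], and unitaries are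
    mapped to unitaries, which have norm one. *)
Lemma ush_contract_selfadjoint a :
  star a = a -> cnorm a < 1 -> cnorm (f a) <= 1.
Proof.
move=> sa a1.
have aa1 : cnorm (a * a) < 1.
  by rewrite -{1}sa cnorm_starM expr_lt1// cnorm_ge0.
have saa : star (a * a) = a * a by rewrite starM sa.
have [s [ss ssa as_]] := ex_sqrt aa1 saa.
have {}as_ : a * s = s * a by apply: as_; rewrite mulrA.
have sum_squares (c : R[i]) : c * c = -1 -> (a - c *: s) * (a + c *: s) = 1.
  move=> cc; rewrite mulrDr !mulrBl -!scalerAl -!scalerAr scalerA cc as_.
  by rewrite scaleN1r ss opprK addrA subrK addrCA subrr addr0.
have ii : 'i * 'i = -1 :> R[i] by rewrite -expr2 sqrCi.
have uv : (a - 'i *: s) * (a + 'i *: s) = 1 by exact: sum_squares.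
have vu : (a + 'i *: s) * (a - 'i *: s) = 1.
  by have := sum_squares (- 'i); rewrite scaleNr opprK mulrNN; exact.
have star_u : star (a + 'i *: s) = a - 'i *: s.
  by rewrite starD star_iZ sa ssa scaleNr.
have star_v : star (a - 'i *: s) = a + 'i *: s by rewrite -star_u starK.
have uU : unitary (a + 'i *: s) by rewrite /unitary star_u.
have vU : unitary (a - 'i *: s) by rewrite /unitary star_v.
have u1 := cnorm_unitary (ush_unitary uU).
have v1 := cnorm_unitary (ush_unitary vU).
have := ler_cnormD (f (a + 'i *: s)) (f (a - 'i *: s)).
rewrite u1 v1 -ushD addrACA subrr addr0 -mulr2n -scaler_nat ushZ.
have -> : 2%:R = 2%:R%:C :> R[i] by rewrite rmorph_nat.
by rewrite cnorm_realZ//; lra.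
Qed.

(** Rescaling by any number above [cnorm a] gives the inequality for
    self-adjoint [a], and the C*-identity extends it from [star x * x] to
    [x]. *)
Lemma ush_contract x : cnorm (f x) <= cnorm x.
Proof.
have sa_le a : star a = a -> cnorm (f a) <= cnorm a.
  move=> sa; apply/ler_addgt0Pr => e e0.
  have t0 : 0 < cnorm a + e by rewrite ltr_wpDl// cnorm_ge0.
  have ti0 : 0 <= (cnorm a + e)^-1 by rewrite invr_ge0 ltW.
  have := @ush_contract_selfadjoint ((cnorm a + e)^-1%:C *: a).
  rewrite star_realZ sa ushZ !cnorm_realZ// mulrC ltr_pdivrMr// mul1r ltrDl.
  by move=> /(_ erefl e0); rewrite mulrC ler_pdivrMr// mul1r.
rewrite -(@ler_pXn2r _ 2) ?nnegrE ?cnorm_ge0//.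
rewrite -!cnorm_starM -(ush_star fh) -(ush_mul fh).
by apply: sa_le; rewrite starM starK.
Qed.

End StarHom.

(** * Closed star-subalgebras and density in direct limits *)

(** The closure properties are bundled with the predicate, so that the algebra
    structures on the subtype [subalg] can be inferred from it. *)
Record closed_star_subalg (R : realType) (A : cstarAlgType R) :=
  ClosedStarSubalg {
    carrier :> {pred A};
    carrier_alg : GRing.subsemialg_closed carrier;
    carrier_star : forall x, x \in carrier -> star x \in carrier;
    carrier_closed : forall (u : nat -> A) l,
      (forall n, u n \in carrier) -> ccvg u l -> l \in carrier
  }.

HB.instance Definition _ (R : realType) (A : cstarAlgType R)
    (S : closed_star_subalg A) :=
  GRing.isSubalgClosed.Build R[i] A (carrier S) (carrier_alg S).

Section Subalgebra.
Variables (R : realType) (A : cstarAlgType R) (S : closed_star_subalg A).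

Record subalg := Subalg { incl :> A; inclP : incl \in carrier S }.

HB.instance Definition _ := [isSub for incl].
HB.instance Definition _ := [Choice of subalg by <:].
HB.instance Definition _ := [SubChoice_isSubAlgebra of subalg by <:].

Definition sub_star (x : subalg) := Subalg (carrier_star (inclP x)).
Definition sub_norm (x : subalg) := cnorm (incl x).

Lemma sub_starK : involutive sub_star.
Proof. by move=> x; apply: val_inj; exact: starK. Qed.
Lemma sub_starD : {morph sub_star : x y / x + y}.
Proof. by move=> x y; apply: val_inj; exact: starD. Qed.
Lemma sub_starZ (c : R[i]) (x : subalg) : sub_star (c *: x) = c^* *: sub_star x.
Proof. by apply: val_inj; exact: starZ. Qed.
Lemma sub_starM x y : sub_star (x * y) = sub_star y * sub_star x.
Proof. by apply: val_inj; exact: starM. Qed.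
Lemma sub_normD x y : sub_norm (x + y) <= sub_norm x + sub_norm y.
Proof. exact: ler_cnormD. Qed.
Lemma sub_normZ (c : R[i]) x : sub_norm (c *: x) = normc c * sub_norm x.
Proof. exact: cnormZ. Qed.
Lemma sub_norm0 x : sub_norm x = 0 -> x = 0.
Proof. by move=> /cnorm0_eq0 x0; apply: val_inj. Qed.
Lemma sub_normM x y : sub_norm (x * y) <= sub_norm x * sub_norm y.
Proof. exact: ler_cnormM. Qed.
Lemma sub_norm_starM x : sub_norm (sub_star x * x) = sub_norm x ^+ 2.
Proof. exact: cnorm_starM. Qed.
Lemma sub_complete (u : nat -> subalg) :
  (forall e : R, 0 < e -> exists N, forall m n, (N <= m)%N -> (N <= n)%N ->
     sub_norm (u m - u n) < e) ->
  exists l, sub_norm (u n - l) @[n --> \oo] --> (0 : R).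
Proof.
move=> /cnorm_complete[l ul].
by exists (Subalg (carrier_closed (fun n => inclP (u n)) ul)).
Qed.

HB.instance Definition _ := @Algebra_isCStarAlgebra.Build R subalg
  sub_star sub_norm sub_starK sub_starD sub_starZ sub_starM sub_normD sub_normZ
  sub_norm0 sub_normM sub_norm_starM sub_complete.

End Subalgebra.

Section DirectLimit.
Variables (R : realType) (M : nat -> cstarAlgType R).
Variables (iota : forall n, M n -> M n.+1) (A : cstarAlgType R).
Variable phi : forall n, M n -> A.
Hypothesis A_limit : is_direct_limit iota phi.

Definition union_range : set A := [set a | exists n (x : M n), a = phi x].

Lemma phi_lift n p (x : M n) : (n <= p)%N -> exists y : M p, phi x = phi y.
Proof.
move=> /subnKC <-; elim: (p - n)%N => [|m [y xy]].
  by rewrite addn0; exists x.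
by rewrite addnS; exists (iota y); rewrite (dl_cocone A_limit).
Qed.

(** The connecting maps make the union directed; this is what makes it an
    algebra. *)
Lemma union_range2 a b : union_range a -> union_range b ->
  exists n (x y : M n), a = phi x /\ b = phi y.
Proof.
move=> [n [x ->]] [p [y ->]]; exists (maxn n p).
have [x' ->] := phi_lift x (leq_maxl n p).
by have [y' ->] := phi_lift y (leq_maxr n p); exists x', y'.
Qed.

Definition union_closure : {pred A} :=
  [pred a | `[< exists2 u, forall n, union_range (u n) & ccvg u a >]].

Lemma union_closureP a :
  reflect (exists2 u, forall n, union_range (u n) & ccvg u a)
    (a \in union_closure).
Proof. exact: asboolP. Qed.

Lemma union_closure_range n (x : M n) : phi x \in union_closure.
Proof.
apply/union_closureP; exists (fun=> phi x) => [_|]; first by exists n, x.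
exact: ccvg_cst.
Qed.

Lemma union_closure_alg : GRing.subsemialg_closed union_closure.
Proof.
have hom := dl_hom A_limit; split.
- by rewrite -(ush_one (hom 0)); exact: union_closure_range.
- split; first by rewrite -(ush0 (hom 0)); exact: union_closure_range.
  move=> a b /union_closureP[u Du ua] /union_closureP[v Dv vb].
  apply/union_closureP; exists (fun n => u n + v n); last exact: ccvgD.
  move=> n; have [p [x [y [-> ->]]]] := union_range2 (Du n) (Dv n).
  by exists p, (x + y); rewrite (ushD (hom p)).
- move=> c a /union_closureP[u Du ua].
  apply/union_closureP; exists (fun n => c *: u n); last exact: ccvgZ.
  move=> n; have [p [x ->]] := Du n.
  by exists p, (c *: x); rewrite (ushZ (hom p)).
- move=> a b /union_closureP[u Du ua] /union_closureP[v Dv vb].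
  apply/union_closureP; exists (fun n => u n * v n); last exact: ccvgM.
  move=> n; have [p [x [y [-> ->]]]] := union_range2 (Du n) (Dv n).
  by exists p, (x * y); rewrite (ush_mul (hom p)).
Qed.

Lemma union_closure_star x : x \in union_closure -> star x \in union_closure.
Proof.
move=> /union_closureP[u Du ux]; apply/union_closureP.
exists (fun n => star (u n)); last exact: ccvg_star.
move=> n; have [p [y ->]] := Du n.
by exists p, (star y); rewrite (ush_star (dl_hom A_limit p)).
Qed.

Lemma union_closure_closed (u : nat -> A) l :
  (forall n, u n \in union_closure) -> ccvg u l -> l \in union_closure.
Proof.
move=> uD ul.
(* Diagonal choice: [v n] is within [1 / (n + 1)] of [u n]. *)
have /choice[v vP] n : exists d, union_range d /\ cnorm (d - u n) < n.+1%:R^-1.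
  have /union_closureP[w wD wu] := uD n.
  have [|m wm] := ccvg_small wu (_ : 0 < n.+1%:R^-1); first by rewrite invr_gt0.
  by exists (w m).
apply/union_closureP; exists v => [n|]; first by have [] := vP n.
apply: (@ccvg_squeeze _ _ _ _ (fun n => n.+1%:R^-1 + cnorm (u n - l))) => [n|].
  rewrite -(subrK (u n) (v n)) -addrA (le_trans (ler_cnormD _ _))// lerD2r.
  by have [_ /ltW] := vP n.
by rewrite -[X in _ --> X](addr0 (0 : R)); apply: cvgD => //;
   exact: cvg_harmonic.
Qed.

(** The closure [S] of the union of the ranges is itself a cocone, so the
    universal property gives [h : A -> S]; by uniqueness [h] followed by the
    inclusion of [S] in [A] is the identity, hence [S] is all of [A]. *)
Lemma union_range_dense (a : A) (e : R) : 0 < e ->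
  exists n (x : M n), cnorm (phi x - a) < e.
Proof.
move=> e0.
pose S := ClosedStarSubalg union_closure_alg union_closure_star
  union_closure_closed.
pose psi n (x : M n) : subalg S :=
  Subalg (union_closure_range x : _ \in carrier S).
have psi_hom n : unital_star_hom (@psi n).
  have [fl fm f1 fs] := dl_hom A_limit n.
  by split=> [c x y|x y||x]; apply: val_inj; rewrite /= ?fl ?fm ?f1 ?fs.
have psi_cocone n x : psi n.+1 (iota x) = psi n x.
  by apply: val_inj; exact: dl_cocone A_limit _ _.
have [h h_hom hphi] := dl_exists A_limit psi_hom psi_cocone.
have comp_hom : unital_star_hom (fun x => incl (h x)).
  have [fl fm f1 fs] := h_hom.
  by split=> [c x y|x y||x] /=; rewrite ?fl ?fm ?f1 ?fs.
have id_hom : unital_star_hom (@id A) by [].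
have ha : incl (h a) = a.
  by apply: (dl_unique A_limit comp_hom id_hom) => n x /=; rewrite hphi.
have /union_closureP[u uD ua] := inclP (h a).
have [n un] := ccvg_small ua e0; have [p [x ux]] := uD n.
by exists p, x; rewrite -ux -{1}ha.
Qed.

End DirectLimit.

(** * Roots of unity *)

(** In characteristic 0, [X^n - 1] is separable, so it has [n] distinct roots,
    and a finite group of units of a field is cyclic. *)
Lemma closed_prim_root_exists (C : numClosedFieldType) (n : nat) : (0 < n)%N ->
  exists z : C, n.-primitive_root z.
Proof.
move=> n_gt0; have [r Dp] := closed_field_poly_normal ('X^n - 1 : {poly C}).
rewrite (monicP _) ?monicXnsubC // scale1r in Dp.
have rn1 : all n.-unity_root r.
  by apply/allP => z; rewrite -root_prod_XsubC -Dp.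
have sz_r : (n <= size r)%N.
  by rewrite -ltnS -(size_prod_XsubC r id) -Dp size_XnsubC.
have r_uniq : uniq r.
  by rewrite -separable_prod_XsubC -Dp separable_Xn_sub_1// pnatr_eq0 -lt0n.
by have /hasP[z _ zn] := has_prim_root n_gt0 rn1 r_uniq sz_r; exists z.
Qed.

Lemma circle_prim_root (R : realType) (n : nat) (z : R[i]) :
  n.-primitive_root z -> circle z.
Proof.
move=> zn; have n0 := prim_order_gt0 zn.
by apply/eqP; rewrite -(pexpr_eq1 n0)// -normrX (prim_expr_order zn) normr1.
Qed.

Lemma circle_neq0 (R : realType) (z : R[i]) : circle z -> z != 0.
Proof. by move=> z1; rewrite -normr_eq0 z1 oner_eq0. Qed.

Lemma circleX (R : realType) (z : R[i]) n : circle z -> circle (z ^+ n).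
Proof. by move=> z1; rewrite /circle /= normrX z1 expr1n. Qed.

(** * Rotated matrices are singular *)

Section Matrix.
Variables (R : realType) (N : nat).
Implicit Types w x y : cmatrix R N.

(** A full matrix algebra is simple: cutting [w] down by matrix units yields
    all diagonal units, hence the identity, from any nonzero entry of [w]. *)
Lemma ush_matrix_inj (A : cstarAlgType R) (f : cmatrix R N -> A) w :
  unital_star_hom f -> f w = 0 -> w = 0.
Proof.
move=> fh fw0; apply/matrixP => i j; rewrite mxE; apply/eqP/negPn/negP => wij.
pose E k l : cmatrix R N := delta_mx k l.
have fE k : f (E k k) = 0.
  have : f (E k i * w * E j k) = 0.
    by rewrite !(ush_mul fh) fw0 mulr0 mul0r.
  have -> : E k i * w * E j k = w i j *: E k k.
    change (delta_mx k i *m w *m delta_mx j k = w i j *: delta_mx k k).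
    rewrite -(mul_delta_mx (0 : 'I_1) k i) -(mul_delta_mx (0 : 'I_1) j k).
    rewrite !mulmxA -(mulmxA (delta_mx k 0)) -rowE.
    rewrite -(mulmxA (delta_mx k 0)) -colE [col j _]mx11_scalar !mxE.
    by rewrite mul_mx_scalar -scalemxAl mul_delta_mx.
  by rewrite (ushZ fh) => /eqP; rewrite scaler_eq0 (negbTE wij) => /eqP.
have : (1 : A) = 0.
  rewrite -(ush_one fh) (_ : 1 = \sum_k E k k); last exact: mx1_sum_delta.
  by rewrite (ush_sum fh) big1.
by move/eqP; rewrite oner_eq0.
Qed.

Lemma eigenvalue_notin_unitmx (F : fieldType) n (g : 'M[F]_n) a :
  eigenvalue g a = (g - a%:M \notin unitmx).
Proof. by rewrite /eigenvalue /eigenspace kermx_eq0 row_free_unit. Qed.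

(** A unital homomorphism preserves invertibility, and [s] sends
    [y - (z * a) *: 1] to [z *: (y - a *: 1)]. *)
Lemma eigenvalue_rotate (s : cmatrix R N -> cmatrix R N) (z a : R[i]) y :
  unital_star_hom s -> s y = z *: y ->
  eigenvalue y a -> eigenvalue y (z * a).
Proof.
move=> sh sy; rewrite !eigenvalue_notin_unitmx; apply: contra => yza.
pose B : cmatrix R N := invmx (y - (z * a)%:M).
have cM (c : R[i]) : c *: (1 : cmatrix R N) = (c%:M : 'M[R[i]]_N.+1).
  exact: scalemx1.
have yB : (y - (z * a) *: 1) * B = 1 by rewrite cM; exact: mulmxV.
have : s (y - (z * a) *: 1) * s B = 1 by rewrite -(ush_mul sh) yB (ush_one sh).
rewrite (ushB sh) (ushZ sh) sy (ush_one sh) -scalerA -scalerBr.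
rewrite -scalerAl scalerAr.
by rewrite cM => /mulmx1_unit[].
Qed.

(** Starting from one nonzero eigenvalue, the powers of [z] would give [N + 2]
    distinct roots of the characteristic polynomial, whose degree is [N + 1]. *)
Lemma rotated_notin_unitmx (s : cmatrix R N -> cmatrix R N) (z : R[i]) y :
  unital_star_hom s -> N.+2.-primitive_root z -> s y = z *: y ->
  (y : 'M[R[i]]_N.+1) \notin unitmx.
Proof.
move=> sh zN sy; apply/negP => yU.
pose p := char_poly (y : 'M[R[i]]_N.+1).
have eigE b : eigenvalue (y : 'M[R[i]]_N.+1) b = root p b.
  exact: eigenvalue_root_char.
have sz_p : size p = N.+2 by exact: size_char_poly.
have p0 : p != 0 by rewrite -size_poly_gt0 sz_p.
have [|a] := closed_rootP p _; first by rewrite sz_p.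
rewrite -eigE => ya.
have a0 : a != 0.
  apply: contraL ya => /eqP ->.
  by rewrite eigenvalue_notin_unitmx raddf0 subr0 yU.
have yza j : eigenvalue (y : 'M[R[i]]_N.+1) (z ^+ j * a).
  elim: j => [|j IH]; first by rewrite mul1r.
  by rewrite exprS -mulrA; exact: eigenvalue_rotate sh sy IH.
pose rs := [seq z ^+ (j : 'I_N.+2) * a | j <- enum 'I_N.+2].
have rs_root : all (root p) rs.
  by apply/allP => _ /mapP[j _ ->]; rewrite -eigE; exact: yza.
have rs_uniq : uniq rs.
  rewrite map_inj_uniq ?enum_uniq// => i j /(mulIf a0)/eqP.
  rewrite (eq_prim_root_expr zN) !modn_small// => /eqP ij.
  exact: val_inj.
have := max_poly_roots p0 rs_root rs_uniq.
by rewrite sz_p size_map size_enum_ord ltnn.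
Qed.

(** If [w * y = 0] then [f w = - f w * ((f y - u) * star u)], whose last factor
    has norm less than one; this forces [f w = 0].  Invertibility is thus
    obtained in the matrix algebra itself, without comparing norms there. *)
Lemma near_unitary_unitmx (A : cstarAlgType R) (f : cmatrix R N -> A)
    y (u : A) :
  unital_star_hom f -> unitary u -> cnorm (f y - u) < 1 ->
  (y : 'M[R[i]]_N.+1) \in unitmx.
Proof.
move=> fh uU fyu; rewrite -row_free_unit -kermx_eq0; apply/eqP.
pose w : cmatrix R N := kermx y; rewrite -/w.
have wy : w * y = 0 by exact: mulmx_ker.
apply: (ush_matrix_inj fh).
have fw : f w = - (f w * ((f y - u) * star u)).
  rewrite mulrBl mulrBr mulrA -(ush_mul fh) wy (ush0 fh) mul0r sub0r opprK.
  by have [_ ->] := uU; rewrite mulr1.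
have su : cnorm (star u) = 1 by rewrite cnorm_star cnorm_unitary.
have c1 : cnorm ((f y - u) * star u) < 1.
  by apply: le_lt_trans fyu; rewrite -[leRHS]mulr1 -su ler_cnormM.
have : cnorm (f w) <= cnorm (f w) * cnorm ((f y - u) * star u).
  by rewrite {1}fw cnormN ler_cnormM.
have := cnorm_ge0 (f w); rewrite le_eqVlt => /orP[/eqP/esym/cnorm0_eq0//|w0].
by rewrite -{1}(mulr1 (cnorm (f w))) ler_pM2l// leNgt c1.
Qed.

End Matrix.

(** * Averaging over roots of unity *)

Section RotatedMean.
Variables (R : realType) (m : nat) (z : R[i]).
Hypotheses (m0 : (0 < m)%N) (zC : circle z) (zm : z ^+ m = 1).

(** The spectral projection of [x] onto the elements that [alpha z] multiplies
    by [z], for the cyclic group generated by [z]. *)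
Definition rotated_mean (A : cstarAlgType R) (alpha : circle_action A)
    (x : A) :=
  m%:R^-1%:C *: \sum_(j < m) (z ^- j) *: alpha (z ^+ j) x.

Lemma act_rotated_mean (A : cstarAlgType R) (alpha : circle_action A) x :
  alpha z (rotated_mean alpha x) = z *: rotated_mean alpha x.
Proof.
have [zh _] := act_aut alpha zC.
rewrite (ushZ zh) (ush_sum zh) /rotated_mean scalerA mulrC -scalerA.
congr (_ *: _); rewrite scaler_sumr.
pose g j := z ^- j *: alpha (z ^+ j) x.
have -> : \sum_(j < m) alpha z (z ^- j *: alpha (z ^+ j) x) =
    \sum_(j < m) z *: g j.+1.
  apply: eq_bigr => j _; rewrite (ushZ zh) /g scalerA.
  rewrite -(act_mul alpha zC (circleX j zC)) -exprS; congr (_ *: _).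
  by rewrite exprS invfM mulrA mulfV ?(circle_neq0 zC)// mul1r.
rewrite -!scaler_sumr; congr (_ *: _).
case: m zm => [|p] zp; first by rewrite !big_ord0.
rewrite big_ord_recr big_ord_recl /= addrC; congr (_ + _).
by rewrite /g zp expr0.
Qed.

(** The bound does not depend on [m], since every term of the mean is within
    [d + e] of [u]: [alpha (z ^+ j)] does not increase the distance of [x] and
    [u]. *)
Lemma rotated_mean_near (A : cstarAlgType R) (alpha : circle_action A) (x u : A)
    (d e : R) :
  (forall w, circle w -> cnorm (alpha w u - w *: u) < e) ->
  cnorm (x - u) < d -> cnorm (rotated_mean alpha x - u) < d + e.
Proof.
move=> ue xd.
have term j : cnorm (z ^- j *: alpha (z ^+ j) x - u) < d + e.
  have zj := circleX j zC; have [zh _] := act_aut alpha zj.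
  have -> : z ^- j *: alpha (z ^+ j) x - u =
      z ^- j *: (alpha (z ^+ j) x - z ^+ j *: u).
    by rewrite scalerBr scalerA mulVf ?scale1r// expf_neq0// (circle_neq0 zC).
  rewrite cnormZ Normc.normcV (normc_circle zj) invr1 mul1r.
  rewrite -(subrK (alpha (z ^+ j) u) (alpha _ x)) -addrA.
  rewrite (le_lt_trans (ler_cnormD _ _))// ltrD ?ue//.
  by rewrite -(ushB zh) (le_lt_trans (ush_contract zh _)).
have mR : 0 < m%:R :> R by rewrite ltr0n.
have -> : rotated_mean alpha x - u =
    m%:R^-1%:C *: \sum_(j < m) (z ^- j *: alpha (z ^+ j) x - u).
  rewrite sumrB scalerBr sumr_const card_ord -[u *+ m]scaler_nat scalerA.
  congr (_ - _); rewrite -(rmorph_nat (real_complex R)) -rmorphM/=.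
  by rewrite mulVf ?gt_eqF// scale1r.
rewrite cnorm_realZ ?invr_ge0 ?ltW// mulrC ltr_pdivrMr//.
rewrite (le_lt_trans (cnorm_sum _ _))//.
rewrite mulr_natr -[X in _ *+ X](card_ord m) -sumr_const.
apply: ltr_sum => [|j _]; last exact: term.
by apply/hasP; exists (Ordinal m0); rewrite ?mem_index_enum.
Qed.

Lemma rotated_mean_map (A B : cstarAlgType R) (f : A -> B)
    (alpha : circle_action A) (beta : circle_action B) x :
  unital_star_hom f ->
  (forall w, circle w -> forall x, beta w (f x) = f (alpha w x)) ->
  f (rotated_mean alpha x) = rotated_mean beta (f x).
Proof.
move=> fh fab; rewrite (ushZ fh) (ush_sum fh); congr (_ *: _).
by apply: eq_bigr => j _; rewrite (ushZ fh) fab//; exact: circleX.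
Qed.

End RotatedMean.

(** * Failure of the Rokhlin property *)

Theorem theorem2p17 (R : realType) (k : nat -> nat)
    (iota : forall n : nat, cmatrix R (k n) -> cmatrix R (k n.+1))
    (A : cstarAlgType R) (phi : forall n : nat, cmatrix R (k n) -> A)
    (alphan : forall n : nat, circle_action (cmatrix R (k n)))
    (alpha : circle_action A)
    (iota_hom : forall n : nat, unital_star_hom (iota n))
    (A_limit : is_direct_limit (M := fun n => cmatrix R (k n)) iota phi)
    (equivariant : forall (n : nat) (z : complex R), circle z ->
       forall x : cmatrix R (k n),
         iota n (alphan n z x) = alphan n.+1 z (iota n x))
    (alpha_limit : is_limit_action (M := fun n => cmatrix R (k n))
       phi alphan alpha) :
  ~ rokhlin_property alpha.
Proof.
(* Two errors of 1/2 add up to a distance less than 1. *)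
move=> /(_ set0 2^-1 (finite_set0 _))[|u [uU ua _]]; first by rewrite invr_gt0.
have [|n [x xu]] := union_range_dense A_limit u (_ : 0 < 2^-1).
  by rewrite invr_gt0.
have [z zP] := closed_prim_root_exists R[i] (ltn0Sn (k n).+1).
have zC := circle_prim_root zP; have z1 := prim_expr_order zP.
have [zh _] := act_aut (alphan n) zC.
have /negP := rotated_notin_unitmx zh zP (act_rotated_mean zC z1 (alphan n) x).
apply; apply: (near_unitary_unitmx (dl_hom A_limit n) uU).
rewrite (rotated_mean_map _ zC _ (dl_hom A_limit n) (alpha_limit n)).
by rewrite [ltRHS]splitr mul1r; exact: rotated_mean_near.
Qed.
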